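(* Let $X\in\mathbb{R}^{NK\times NK}$ be symmetric with $K\times K$ blocks $X^{(i,j)}$, $i,j=1,\dots,N$. Suppose that $X\succeq0$ and $\sum_{i=1}^N\|X^{(i,i)}-\mathbf{I}_K\|_{\mathrm{Tr}}\le\delta$. Then there exists $X'\succeq0$ with $[X']^{(i,i)}=\mathbf{I}_K$ for all $i=1,\dots,N$, such that for any symmetric $A\in\mathbb{R}^{NK\times NK}$, $$\mathrm{Tr}[A(X-X')]\le(2K+1)\,\delta\,|||A|||,\qquad\text{where}\quad |||A|||:=\max_{i=1,\dots,N}\sum_{j=1}^N\|A^{(i,j)}\|_2.$$
   Context: For an $NK\times NK$ matrix $A$, $A^{(i,j)}$ denotes its $(i,j)$ block of size $K\times K$. $\|\cdot\|_2$ is the spectral norm and $\|\cdot\|_{\mathrm{Tr}}$ the nuclear norm (sum of singular values). *)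

(* Defs.v *)
From mathcomp Require Export all_boot all_order all_algebra.
From mathcomp Require Export reals.
From mathcomp Require Export polyrcf.

Set Implicit Arguments.
Unset Strict Implicit.
Unset Printing Implicit Defensive.

Import Order.TTheory GRing.Theory Num.Theory.

Local Open Scope ring_scope.

Definition psd (R : realType) (n : nat) (A : 'M[R]_n) : Prop :=
  A^T = A /\ forall v : 'cV[R]_n, 0 <= (v^T *m A *m v) 0 0.

(* [rootsR p] lists the distinct real roots of [p]; every root of the
   characteristic polynomial of [A^T *m A] is real and nonnegative, so this
   is the complete list of the [n] singular values of [A], each repeated
   according to its multiplicity. *)
Definition singular_values (R : realType) (n : nat) (A : 'M[R]_n) : seq R :=
  let p := char_poly (A^T *m A) in
  flatten [seq nseq (mup x p) (Num.sqrt x) | x <- rootsR p].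

(* Singular values are nonnegative, so the default value [0] only matters when
   [n = 0]. *)
Definition spectral_norm (R : realType) (n : nat) (A : 'M[R]_n) : R :=
  \big[Num.max/0]_(s <- singular_values A) s.

Definition nuclear_norm (R : realType) (n : nat) (A : 'M[R]_n) : R :=
  \sum_(s <- singular_values A) s.

(* An [N K x N K] matrix is indexed by ['I_(\sum_(i < N) K)], the index type
   for which the library provides the [K x K] blocks [submxblock A i j]. *)
Definition block_norm (R : realType) (N K : nat)
    (A : 'M[R]_(\sum_(i < N) K)) : R :=
  \big[Num.max/0]_(i < N) \sum_(j < N) spectral_norm (submxblock A i j).

(* Main.v *)
Require Import Defs.
From mathcomp Require Import complex spectral sesquilinear.
From mathcomp Require Import ring lra.

(* Let D_i be the diagonal blocks of X and f x = min(1, x^(-1/2)). With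
   S = diag(f(D_1), ..., f(D_N)) and E = 1 - S, the matrix
   X' = S X S + diag(1 - f(D_i)^2 D_i) is positive semidefinite with identity
   diagonal blocks. In X - S X S = E X E + E X S + S X E every block pairing
   with A is estimated by Cauchy-Schwarz for the semi-inner product of X,
   which leaves only the diagonal blocks E_i D_i E_i and the contractions
   S_j D_j S_j. An eigenvalue x of D_i then contributes
   (1 - f x)^2 x + 2 (1 - f x) sqrt x + (1 - (f x)^2 x) = |x - 1|
   times a block row sum of A, so the inequality even holds with the
   constant 1. *)

Import Order.TTheory GRing.Theory Num.Theory.
Local Open Scope ring_scope.

Set Implicit Arguments.
Unset Strict Implicit.
Unset Printing Implicit Defensive.

(** * Orthogonal diagonalization of real symmetric matrices *)

(** Over the complex extension [A] is Hermitian, hence unitarily diagonalizable with a real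
    diagonal. The first diagonal entry has the first row of [P] as left eigenvector, and being a
    root of the characteristic polynomial descends along the embedding of [R]. *)
Lemma symmetric_eigenvalue (R : rcfType) n (A : 'M[R]_n.+1) :
  A^T = A -> exists a, eigenvalue A a.
Proof.
move=> A_sym; pose AC := map_mx (real_complex R) A.
have AC_herm : AC \is hermsymmx.
  apply/is_hermitianmxP; rewrite expr0 scale1r; apply/matrixP => i j.
  rewrite !mxE -{1}A_sym mxE; apply/esym/CrealP.
  by apply/complex_realP; exists (A j i).
have /mxOverP /(_ 0 0) /complex_realP [a a_def] :=
  hermitian_spectral_diag_real AC_herm.
exists a; rewrite eigenvalue_root_char -(fmorph_root (real_complex R)).
rewrite map_char_poly /= -a_def -eigenvalue_root_char.
have /orthomx_spectralP := hermitian_normalmx AC_herm.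
have := spectral_unit AC; move: (spectralmx AC) (spectral_diag AC) => P D.
move=> P_unit AC_eq.
apply/eigenvalueP; exists (row 0 P).
  rewrite -[map_mx _ A]/AC AC_eq -row_mul !mulmxA mulmxV // mul1mx.
  by rewrite row_mul row_diag_mx -scalemxAl -rowE.
apply/eqP => row0; have := mulmxV P_unit => /(congr1 (row 0)).
rewrite row_mul row0 mul0mx => /rowP /(_ 0); rewrite !mxE eqxx => /esym/eqP.
by rewrite oner_eq0.
Qed.

Lemma tr_gram_ge0 (R : realDomainType) m n (B : 'M[R]_(m, n)) :
  0 <= \tr (B^T *m B).
Proof.
rewrite /mxtrace sumr_ge0 // => i _; rewrite mxE sumr_ge0 // => j _.
by rewrite mxE -expr2 sqr_ge0.
Qed.

Lemma tr_gram_eq0 (R : realDomainType) m n (B : 'M[R]_(m, n)) :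
  (\tr (B^T *m B) == 0) = (B == 0).
Proof.
apply/eqP/eqP => [|->]; last by rewrite mulmx0 mxtrace0.
have ge0 i : 0 <= (B^T *m B) i i.
  by rewrite mxE sumr_ge0 // => j _; rewrite mxE -expr2 sqr_ge0.
move/psumr_eq0P => /(_ (fun i _ => ge0 i)) B0; apply/matrixP => i j.
have := B0 j isT; rewrite mxE => /psumr_eq0P B0j.
have /eqP : B^T j i * B i j = 0.
  by apply: B0j => // k _; rewrite mxE -expr2 sqr_ge0.
by rewrite !mxE mulf_eq0 orbb => /eqP.
Qed.

Lemma scalar_mx11_tr (R : nzRingType) (B : 'M[R]_1) : B = (\tr B)%:M.
Proof. by rewrite [LHS]mx11_scalar /mxtrace big_ord1. Qed.

(* The Householder reflection exchanging [e] and [v / c]. *)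
Lemma orthogonal_first_column (R : rcfType) n (v : 'cV[R]_n.+1) :
  exists (H : 'M[R]_n.+1) c, H^T *m H = 1%:M /\ v = c *: (H *m delta_mx 0 0).
Proof.
pose e : 'cV[R]_n.+1 := delta_mx 0 0.
have ee : e^T *m e = 1%:M.
  rewrite trmx_delta mul_delta_mx; apply/matrixP => i j.
  by rewrite !ord1 !mxE.
pose c : R := Num.sqrt (\tr (v^T *m v)).
have vv : v^T *m v = (c ^+ 2)%:M.
  by rewrite [LHS]scalar_mx11_tr sqr_sqrtr // tr_gram_ge0.
pose w := v - c *: e.
have [w0|w_neq0] := eqVneq w 0.
  exists 1%:M, c; split; first by rewrite trmx1 mul1mx.
  by apply/eqP; rewrite mul1mx -subr_eq0; apply/eqP.
pose x : R := v 0 0.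
have ev : e^T *m v = x%:M.
  by apply/matrixP => i j; rewrite !ord1 trmx_delta -rowE !mxE eqxx mulr1n.
have ve : v^T *m e = x%:M.
  by rewrite -[LHS]trmxK trmx_mul trmxK ev tr_scalar_mx.
have wt : w^T = v^T - c *: e^T by rewrite linearB linearZ.
(* This is the squared length of [w]: as v and c e both have length c, it equals 2 c^2 - 2 c x. *)
pose t : R := 2 * c * (c - x).
have ww : w^T *m w = t%:M.
  rewrite wt /w mulmxBl !mulmxBr -!scalemxAl -!scalemxAr.
  rewrite ee ev ve vv !scale_scalar_mx -!raddfB /=; congr (_%:M).
  by rewrite /t; ring.
have t_neq0 : t != 0.
  by move: w_neq0; rewrite -tr_gram_eq0 ww mxtrace_scalar mulr1n.
have c_neq0 : c != 0 by apply: contraNneq t_neq0; rewrite /t => ->; rewrite mulr0 mul0r.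
have we : w^T *m e = (x - c)%:M.
  rewrite wt mulmxBl -scalemxAl ve ee scale_scalar_mx mulr1.
  by rewrite -raddfB.
pose H := 1%:M - (2 / t) *: (w *m w^T).
have Ht : H^T = H.
  by rewrite /H linearB linearZ /= trmx1 trmx_mul trmxK.
exists H, c; split.
  rewrite Ht {1}/H mulmxBl mul1mx -scalemxAl /H mulmxBr mulmx1 -scalemxAr.
  rewrite mulmxA -[w *m w^T *m w]mulmxA ww mul_mx_scalar -scalemxAl.
  apply/matrixP => i j; rewrite !mxE; field.
  exact: t_neq0.
(* The coefficient of [w] is - (2 / t) (x - c), which simplifies to 1 / c. *)
have -> : H *m delta_mx 0 0 = e + c^-1 *: w.
  rewrite -/e /H mulmxBl mul1mx -scalemxAl -mulmxA we mul_mx_scalar scalerA.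
  rewrite -scaleNr; congr (_ + _ *: _).
  have := t_neq0; rewrite /t !mulf_eq0 !negb_or => /andP[_ cx_neq0].
  by field; rewrite c_neq0 cx_neq0.
by rewrite scalerDr scalerA divff // scale1r /w addrC subrK.
Qed.

Lemma block_diagonalization (R : comNzRingType) (a : R) n (Q : 'M[R]_n) d
    (P := block_mx (1%:M : 'M_1) 0 0 Q) :
  block_mx a%:M 0 0 (Q *m diag_mx d *m Q^T)
  = P *m diag_mx (row_mx (a%:M : 'rV_1) d) *m P^T.
Proof.
rewrite diag_mx_row tr_block_mx !trmx0 trmx1 !mulmx_block.
rewrite !(mul0mx, mulmx0, mul1mx, mulmx1, addr0, add0r).
by congr block_mx; apply/matrixP => i j; rewrite !ord1 !mxE.
Qed.

(** Deflation: conjugating by a reflection whose first column is parallel to an eigenvector makes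
    the first column of [B] equal to a e. By symmetry [B] is then block diagonal, and the induction
    hypothesis treats its lower right block. *)
Lemma symmetric_diagonalization (R : rcfType) n (A : 'M[R]_n) : A^T = A ->
  exists Q (d : 'rV[R]_n), Q^T *m Q = 1%:M /\ A = Q *m diag_mx d *m Q^T.
Proof.
elim: n A => [|n IHn] A A_sym.
  by exists 1%:M, 0; split; apply/matrixP => -[].
have [a /eigenvalueP [w wA w_neq0]] := symmetric_eigenvalue A_sym.
have [H [c [HH w_def]]] := orthogonal_first_column w^T.
have c_neq0 : c != 0.
  apply: contraNneq w_neq0 => c0; move: w_def; rewrite c0 scale0r.
  by move/(congr1 trmx); rewrite trmxK trmx0 => ->.
have Aw : A *m w^T = a *: w^T by rewrite -{1}A_sym -trmx_mul wA linearZ.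
pose e : 'cV[R]_n.+1 := delta_mx 0 0.
rewrite -/e in w_def.
pose B : 'M[R]_n.+1 := H^T *m A *m H.
have Bt : B^T = B by rewrite /B !trmx_mul trmxK A_sym mulmxA.
have Be : B *m e = a *: e.
  apply: (scalerI c_neq0); rewrite /B -mulmxA scalemxAr -w_def -mulmxA Aw.
  by rewrite -scalemxAr w_def -scalemxAr mulmxA HH mul1mx scalerA mulrC -scalerA.
have HH' : H *m H^T = 1%:M by apply: mulmx1C.
have A_eq : A = H *m B *m H^T.
  by rewrite /B !mulmxA HH' mul1mx -mulmxA HH' mulmx1.
clearbody B.
have Bcol i : B i 0 = a *+ (i == 0).
  have := congr1 (fun M : 'cV_n.+1 => M i 0) Be.
  by rewrite -colE !mxE eqxx andbT mulr_natr.
have [Q [d [QQ B_eq]]] : exists Q (d : 'rV[R]_n),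
    Q^T *m Q = 1%:M /\ @drsubmx R 1 n 1 n B = Q *m diag_mx d *m Q^T.
  by apply: IHn; rewrite trmx_drsub Bt.
have l0 (j : 'I_1) : @lshift 1 n j = 0 :> 'I_n.+1.
  by rewrite ord1; apply/val_inj.
have B_block : B = block_mx (a%:M : 'M_1) 0 0 (@drsubmx R 1 n 1 n B).
  apply: etrans (esym (@submxK R 1 n 1 n B)) _.
  congr (@block_mx _ 1 n 1 n _ _ _ _); apply/matrixP => i j.
  - by rewrite !ord1 !mxE !l0 Bcol eqxx.
  - by rewrite -Bt !mxE l0 Bcol.
  - by rewrite !mxE l0 Bcol.
exists (H *m (block_mx 1%:M 0 0 Q : 'M_(1 + n))), (row_mx a%:M d : 'rV_(1 + n)).
split.
  rewrite trmx_mul mulmxA -[_ *m H^T *m H]mulmxA HH mulmx1.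
  rewrite (@tr_block_mx _ 1 n 1 n) !trmx0 trmx1 (@mulmx_block _ 1 n 1 n 1 n).
  by rewrite !mul0mx !mulmx0 !mul1mx QQ !addr0 add0r -scalar_mx_block.
by rewrite A_eq B_block B_eq block_diagonalization trmx_mul !mulmxA.
Qed.

(** * Singular values, spectral norm and nuclear norm *)

Lemma char_poly_diagonalized (R : comNzRingType) n (Q : 'M[R]_n) d :
  Q^T *m Q = 1%:M ->
  char_poly (Q *m diag_mx d *m Q^T) = \prod_i ('X - (d 0 i)%:P).
Proof.
move=> QQ; pose Qp := map_mx polyC Q.
have QpQp : Qp^T *m Qp = 1%:M by rewrite map_trmx -map_mxM QQ map_mx1.
have -> : char_poly (Q *m diag_mx d *m Q^T) = char_poly (diag_mx d).
  rewrite /char_poly.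
  have -> : char_poly_mx (Q *m diag_mx d *m Q^T)
            = Qp *m char_poly_mx (diag_mx d) *m Qp^T.
    rewrite /char_poly_mx mulmxBr mulmxBl mul_mx_scalar -scalemxAl.
    by rewrite (mulmx1C QpQp) scalemx1 !map_mxM map_trmx.
  rewrite !det_mulmx mulrAC -det_mulmx (mulmx1C QpQp).
  by rewrite det1 mul1r.
rewrite char_poly_trig ?diag_mx_is_trig //.
by apply: eq_bigr => i _; rewrite mxE eqxx.
Qed.

Lemma mup_prod_XsubC (R : fieldType) (s : seq R) y :
  mup y (\prod_(x <- s) ('X - x%:P)) = count_mem y s.
Proof.
elim: s => [|x s IHs] /=; first by rewrite big_nil mupNroot ?root1.
rewrite big_cons mupM ?polyXsubC_eq0 ?IHs //; last first.
  by rewrite prodf_seq_neq0; apply/allP => z _; rewrite polyXsubC_eq0.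
by rewrite -[X in mup _ X]expr1 mup_XsubCX; case: (x == y).
Qed.

(** Each y occurs on both sides as often as its multiplicity as a root. This links the root list in
    [singular_values] to the diagonal of any orthogonal diagonalization. *)
Lemma perm_roots_prod_XsubC (R : rcfType) (s : seq R)
    (p := \prod_(x <- s) ('X - x%:P)) :
  perm_eq (flatten [seq nseq (mup x p) x | x <- rootsR p]) s.
Proof.
have p_neq0 : p != 0.
  by rewrite prodf_seq_neq0; apply/allP => z _; rewrite polyXsubC_eq0.
apply/allP => y _ /=; apply/eqP.
rewrite -[RHS]mup_prod_XsubC -/p count_flatten -map_comp sumnE big_map.
under eq_bigr => x _ do rewrite /= count_nseq /= .
have := roots_on_rootsR p_neq0 y; rewrite in_itv /=.
have [y_root /esym y_in|y_nroot _] := boolP (root p y).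
  rewrite (bigD1_seq y) ?uniq_roots //= eqxx mul1n big1 ?addn0 // => x.
  by move/negPf ->.
rewrite mupNroot // big1 // => x _.
by have [->|//] := eqVneq x y; rewrite mupNroot ?muln0.
Qed.

Lemma perm_singular_values (R : realType) n (B Q : 'M[R]_n) d :
  Q^T *m Q = 1%:M -> B^T *m B = Q *m diag_mx d *m Q^T ->
  perm_eq (singular_values B) [seq Num.sqrt (d 0 i) | i <- enum 'I_n].
Proof.
move=> QQ BB; rewrite /singular_values BB char_poly_diagonalized //.
rewrite (map_comp Num.sqrt) -big_enum -(big_map (d 0) xpredT (fun x => 'X - x%:P)) /=.
set s := map (d 0) _; rewrite -[X in perm_eq X](_ : map Num.sqrt
   (flatten [seq nseq (mup x (\prod_(x <- s) ('X - x%:P))) x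
            | x <- rootsR (\prod_(x <- s) ('X - x%:P))]) = _).
  exact/perm_map/perm_roots_prod_XsubC.
rewrite map_flatten -map_comp; congr flatten; apply: eq_map => x /=.
by rewrite map_nseq.
Qed.

Lemma spectral_norm_ge0 (R : realType) n (B : 'M[R]_n) : 0 <= spectral_norm B.
Proof. exact: bigmax_ge_id. Qed.

(** In an orthonormal eigenbasis of B^T B the left side is the sum of d_i w_i^2, and each sqrt d_i
    is one of the singular values of [B]. *)
Lemma spectral_normP (R : realType) n (B : 'M[R]_n) (v : 'cV_n) :
  \tr ((B *m v)^T *m (B *m v)) <= spectral_norm B ^+ 2 * \tr (v^T *m v).
Proof.
have [|Q [d [QQ BB]]] := @symmetric_diagonalization R n (B^T *m B).
  by rewrite trmx_mul trmxK.
pose w := Q^T *m v.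
have -> : \tr (v^T *m v) = \sum_i w i 0 ^+ 2.
  have -> : v^T *m v = w^T *m w.
    by rewrite trmx_mul trmxK mulmxA -[_ *m Q *m _]mulmxA (mulmx1C QQ) mulmx1.
  rewrite /mxtrace big_ord1 mxE; apply: eq_bigr => i _.
  by rewrite mxE expr2.
have -> : (B *m v)^T *m (B *m v) = w^T *m diag_mx d *m w.
  by rewrite !trmx_mul trmxK mulmxA -[_ *m B^T *m B]mulmxA BB !mulmxA.
have -> : \tr (w^T *m diag_mx d *m w) = \sum_i d 0 i * w i 0 ^+ 2.
  rewrite /mxtrace big_ord1 mxE; apply: eq_bigr => i _.
  by rewrite mul_mx_diag !mxE; ring.
rewrite mulr_sumr ler_sum // => i _; rewrite ler_wpM2r ?sqr_ge0 //.
have le_norm : Num.sqrt (d 0 i) <= spectral_norm B.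
  rewrite /spectral_norm (perm_big _ (perm_singular_values QQ BB)) big_map.
  by rewrite big_enum; apply: le_bigmax.
(* A negative [d 0 i] lies below any square; otherwise [d 0 i] is the square of its root and
   [le_norm] applies. *)
have [d_ge0|/ltW d_le0] := leP 0 (d 0 i); last exact: le_trans d_le0 (sqr_ge0 _).
by rewrite -(sqr_sqrtr d_ge0) ler_sqr ?nnegrE ?sqrtr_ge0 ?spectral_norm_ge0.
Qed.

(** The same [Q] diagonalizes B^T B with the squares of [d], whose roots are the absolute values. *)
Lemma nuclear_norm_symmetric (R : realType) n (B Q : 'M[R]_n) d :
  Q^T *m Q = 1%:M -> B = Q *m diag_mx d *m Q^T ->
  nuclear_norm B = \sum_i `|d 0 i|.
Proof.
move=> QQ B_eq; have BB : B^T *m B = Q *m diag_mx (\row_i d 0 i ^+ 2) *m Q^T.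
  rewrite B_eq !trmx_mul trmxK tr_diag_mx !mulmxA -[_ *m Q^T *m Q]mulmxA QQ.
  rewrite mulmx1 -[Q *m _ *m diag_mx d]mulmxA; congr (_ *m _ *m _).
  by rewrite mulmx_diag; congr diag_mx; apply/rowP => i; rewrite !mxE.
rewrite /nuclear_norm (perm_big _ (perm_singular_values QQ BB)) /= big_map.
by rewrite big_enum; apply: eq_bigr => i _; rewrite mxE sqrtr_sqr.
Qed.

(** * Positive semidefinite matrices and their trace forms *)

Lemma col_form (R : comNzRingType) n m (X : 'M[R]_n) (P Q : 'M_(n, m)) k :
  (P^T *m X *m Q) k k = \tr ((col k P)^T *m X *m col k Q).
Proof.
rewrite /mxtrace big_ord1 tr_col -row_mul mxE [RHS]mxE.
by apply: eq_bigr => j _; rewrite !mxE.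
Qed.

Lemma psd_tr_ge0 (R : realType) n m (X : 'M[R]_n) (P : 'M_(n, m)) :
  psd X -> 0 <= \tr (P^T *m X *m P).
Proof.
move=> [_ X_ge0]; apply: sumr_ge0 => i _.
by rewrite col_form /mxtrace big_ord1.
Qed.

Lemma quadratic_discriminant (R : realFieldType) (a b c : R) : 0 <= a ->
  (forall t, 0 <= t ^+ 2 * a - 2 * t * b + c) -> b ^+ 2 <= a * c.
Proof.
rewrite le_eqVlt => /orP[/eqP <-|a_gt0] q_ge0.
  rewrite mul0r; have [->|b_neq0] := eqVneq b 0; first by rewrite expr0n.
  (* With a = 0 the expression is affine in t: it is c at t = 0 and - 2 - c at this point, and these
     cannot both be nonnegative. *)
  have := q_ge0 ((1 + c) / b); have := q_ge0 0.
  rewrite expr0n !mulr0 mul0r !add0r -mulrA divfK //; lra.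
(* The minimizer of the quadratic. *)
have := q_ge0 (b / a).
have -> : (b / a) ^+ 2 * a - 2 * (b / a) * b + c = (a * c - b ^+ 2) / a.
  by field; rewrite gt_eqF.
by rewrite pmulr_lge0 ?invr_gt0 // subr_ge0.
Qed.

(** The trace of P^T X Q is a semi-inner product of P and Q; its value on t P - Q is a nonnegative
    quadratic in t. *)
Lemma psd_cauchy_schwarz (R : realType) n m (X : 'M[R]_n) (P Q : 'M_(n, m)) :
  psd X -> \tr (P^T *m X *m Q) ^+ 2
           <= \tr (P^T *m X *m P) * \tr (Q^T *m X *m Q).
Proof.
move=> X_psd; have [Xt _] := X_psd.
apply: quadratic_discriminant => [|t]; first exact: psd_tr_ge0.
have QP : \tr (Q^T *m X *m P) = \tr (P^T *m X *m Q).
  by rewrite -mxtrace_tr !trmx_mul trmxK Xt mulmxA.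
have := psd_tr_ge0 (t *: P - Q) X_psd.
have -> : (t *: P - Q)^T = t *: P^T - Q^T by rewrite linearB linearZ.
rewrite mulmxBl -scalemxAl mulmxBl -scalemxAl !mulmxBr -!scalemxAr.
rewrite !raddfB /= !mxtraceZ QP.
by congr (_ <= _); ring.
Qed.

Lemma psd1 (R : realType) n : psd (1%:M : 'M[R]_n).
Proof.
split=> [|v]; first by rewrite trmx1.
rewrite mulmx1 mxE sumr_ge0 // => i _.
by rewrite mxE -expr2 sqr_ge0.
Qed.

Lemma psd_add (R : realType) n (X Y : 'M[R]_n) : psd X -> psd Y -> psd (X + Y).
Proof.
move=> [Xt X_ge0] [Yt Y_ge0]; split=> [|v]; first by rewrite linearD /= Xt Yt.
by rewrite mulmxDr mulmxDl mxE addr_ge0.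
Qed.

Lemma psd_congr (R : realType) n m (X : 'M[R]_n) (P : 'M_(n, m)) :
  psd X -> psd (P^T *m X *m P).
Proof.
move=> [Xt X_ge0]; split=> [|v]; first by rewrite !trmx_mul trmxK Xt mulmxA.
by have := X_ge0 (P *m v); rewrite trmx_mul !mulmxA.
Qed.

Lemma psd_diag (R : realType) n (d : 'rV[R]_n) :
  (forall i, 0 <= d 0 i) -> psd (diag_mx d).
Proof.
move=> d_ge0; split=> [|v]; first by rewrite tr_diag_mx.
rewrite mxE sumr_ge0 // => i _; rewrite mul_mx_diag !mxE.
by rewrite mulrAC -expr2 mulr_ge0 ?sqr_ge0.
Qed.

Lemma psd_sum (R : realType) n N (X : 'I_N -> 'M[R]_n) :
  (forall i, psd (X i)) -> psd (\sum_i X i).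
Proof.
move=> X_psd; apply: (big_ind (@psd R n)) => //; last exact: psd_add.
by split=> [|v]; rewrite ?trmx0 // mulmx0 mul0mx mxE.
Qed.

(** * Operator norm bounds and estimates of cross terms *)

(** Stated for an arbitrary bound [s], so that it passes through transposition and orthogonal
    changes of basis without any return to singular values. The traces are those of 1 x 1 matrices,
    that is, squared lengths. *)
Definition norm_bounded (R : realType) m n (B : 'M[R]_(m, n)) (s : R) :=
  forall v : 'cV_n, \tr ((B *m v)^T *m (B *m v)) <= s ^+ 2 * \tr (v^T *m v).

(** With w = B^T v, Cauchy-Schwarz gives |w|^4 = (v . B w)^2 <= |v|^2 |B w|^2 <= s^2 |v|^2 |w|^2;
    then cancel |w|^2. *)
Lemma norm_bounded_tr (R : realType) m n (B : 'M[R]_(m, n)) s :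
  norm_bounded B s -> norm_bounded B^T s.
Proof.
move=> B_bd v; set w := B^T *m v.
have w_ge0 : 0 <= \tr (w^T *m w) by apply: tr_gram_ge0.
have v_ge0 : 0 <= \tr (v^T *m v) by apply: tr_gram_ge0.
have := psd_cauchy_schwarz v (B *m w) (psd1 R m); rewrite !mulmx1.
have -> : v^T *m (B *m w) = w^T *m w by rewrite [w^T]trmx_mul trmxK mulmxA.
have := B_bd w; set x := \tr (w^T *m w) in w_ge0 *.
set y := \tr (v^T *m v) in v_ge0 *; set z := \tr (_ *m _) => z_le xyz.
have : x * x <= (s ^+ 2 * y) * x.
  rewrite -expr2; apply: le_trans xyz _.
  by rewrite mulrAC [leRHS]mulrC ler_wpM2l.
have [->|x_neq0] := eqVneq x 0; first by rewrite mulr_ge0 ?sqr_ge0.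
by rewrite ler_pM2r // lt_def x_neq0.
Qed.

Lemma norm_bounded_col (R : realType) m n (B : 'M[R]_(m, n)) s j :
  norm_bounded B s -> \tr ((col j B)^T *m col j B) <= s ^+ 2.
Proof.
move=> /(_ (delta_mx j 0)); rewrite -colE => /le_trans -> //.
by rewrite trmx_delta mul_delta_mx /mxtrace big_ord1 !mxE mulr1.
Qed.

Lemma tr_col_square (R : realType) n (v : 'cV[R]_n) :
  \tr (v^T *m v) = \sum_i v i 0 ^+ 2.
Proof.
by rewrite /mxtrace big_ord1 mxE; apply: eq_bigr => i _; rewrite mxE expr2.
Qed.

Lemma norm_bounded_entry (R : realType) m n (B : 'M[R]_(m, n)) s i j :
  0 <= s -> norm_bounded B s -> `|B i j| <= s.
Proof.
move=> s_ge0 /(norm_bounded_col j); rewrite tr_col_square => le_s2.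
rewrite -ler_sqr ?nnegrE // real_normK ?num_real //; apply: le_trans le_s2.
by rewrite (bigD1 i) //= mxE lerDl sumr_ge0 // => k _; rewrite sqr_ge0.
Qed.

(** The trace weights the squared lengths of the rows of [B] by [d]; these rows are columns of B^T,
    each of length at most [s]. *)
Lemma tr_diag_conj_le (R : realType) m n (B : 'M[R]_(m, n)) (d : 'rV_m) s :
  norm_bounded B s -> (forall i, 0 <= d 0 i) ->
  \tr (B^T *m diag_mx d *m B) <= s ^+ 2 * \sum_i d 0 i.
Proof.
move=> /norm_bounded_tr Bt_bd d_ge0.
rewrite mulr_sumr mxtrace_mulC mulmxA [leLHS](_ : _ =
  \sum_i d 0 i * \tr ((col i B^T)^T *m col i B^T)).
  apply: ler_sum => i _; rewrite [leRHS]mulrC ler_wpM2l //.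
  exact: norm_bounded_col.
apply: eq_bigr => i _; rewrite mul_mx_diag mxE mulrC tr_col_square mxE.
by congr (_ * _); apply: eq_bigr => j _; rewrite !mxE expr2.
Qed.

Lemma diag_form_le (R : realType) n (d : 'rV[R]_n) (v : 'cV_n) :
  (forall i, d 0 i <= 1) -> \tr (v^T *m diag_mx d *m v) <= \tr (v^T *m v).
Proof.
move=> d_le1; rewrite tr_col_square /mxtrace big_ord1 mxE; apply: ler_sum => i _.
by rewrite mul_mx_diag !mxE mulrAC -expr2 ler_piMr ?sqr_ge0.
Qed.

(** Cauchy-Schwarz on the whole trace gives s sqrt(a b), where a and b are the sums of [p] and [q].
    The arithmetic mean then replaces sqrt(a b), so that a double sum over blocks separates. *)
Lemma tr_cross_le_mean (R : realType) n K (X : 'M[R]_n) (P Q : 'M_(n, K))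
    (p q : 'rV_K) (B : 'M_K) s :
  psd X -> P^T *m X *m P = diag_mx p -> Q^T *m X *m Q = diag_mx q ->
  (forall k, 0 <= p 0 k) -> (forall k, 0 <= q 0 k) ->
  0 <= s -> norm_bounded B s ->
  \tr (P^T *m X *m (Q *m B)) <= s * ((\sum_k p 0 k + \sum_k q 0 k) / 2).
Proof.
move=> X_psd PXP QXQ p_ge0 q_ge0 s_ge0 B_bd.
have := psd_cauchy_schwarz P (Q *m B) X_psd.
have := tr_diag_conj_le B_bd q_ge0.
rewrite trmx_mul !mulmxA -[_ *m Q^T *m X]mulmxA -[_ *m (_ *m _) *m Q]mulmxA QXQ.
rewrite PXP mxtrace_diag; set a := \sum_k p 0 k; set b := \sum_k q 0 k.
have a_ge0 : 0 <= a by apply: sumr_ge0.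
have b_ge0 : 0 <= b by apply: sumr_ge0.
set t := \tr _; set u := \tr _ => t_le u_le.
have : u ^+ 2 <= (s * ((a + b) / 2)) ^+ 2.
  apply: le_trans u_le _; apply: (@le_trans _ _ (a * (s ^+ 2 * b))).
    by rewrite ler_wpM2l.
  have : 0 <= s ^+ 2 * (a - b) ^+ 2 by rewrite mulr_ge0 ?sqr_ge0.
  by rewrite -subr_ge0 => H; rewrite -subr_ge0; move: H; nra.
rewrite -ler_sqrt ?sqr_ge0 // !sqrtr_sqr => /(le_trans (ler_norm _)) /le_trans.
by apply; rewrite ger0_norm // mulr_ge0 // divr_ge0 ?addr_ge0.
Qed.

(** Cauchy-Schwarz is applied to each column separately: the contraction [q] leaves a factor [s] per
    column, whereas a single application to the trace would cost a factor sqrt K. *)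
Lemma tr_cross_le_sqrt (R : realType) n K (X : 'M[R]_n) (P Q : 'M_(n, K))
    (p q : 'rV_K) (B : 'M_K) s :
  psd X -> P^T *m X *m P = diag_mx p -> Q^T *m X *m Q = diag_mx q ->
  (forall k, 0 <= p 0 k) -> (forall k, q 0 k <= 1) ->
  0 <= s -> norm_bounded B s ->
  \tr (P^T *m X *m (Q *m B)) <= s * \sum_k Num.sqrt (p 0 k).
Proof.
move=> X_psd PXP QXQ p_ge0 q_le1 s_ge0 B_bd; rewrite mulr_sumr.
apply: ler_sum => k _.
have -> : (P^T *m X *m (Q *m B)) k k
          = \tr ((col k P)^T *m X *m (Q *m col k B)).
  by rewrite col_form; congr (\tr (_ *m _)); rewrite !colE mulmxA.
have := psd_cauchy_schwarz (col k P) (Q *m col k B) X_psd.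
have -> : \tr ((col k P)^T *m X *m col k P) = p 0 k.
  by rewrite -col_form PXP mxE eqxx mulr1n.
set u := \tr _; set v := \tr _ => u_le.
have v_le : v <= s ^+ 2.
  apply: le_trans (norm_bounded_col k B_bd).
  apply: le_trans (diag_form_le _ q_le1).
  by rewrite /v trmx_mul -QXQ !mulmxA.
apply: le_trans (ler_norm _) _.
rewrite -ler_sqr ?nnegrE ?mulr_ge0 ?sqrtr_ge0 // real_normK ?num_real //.
rewrite exprMn sqr_sqrtr // mulrC; apply: le_trans u_le _.
by rewrite ler_wpM2l.
Qed.

(** * The scalar shrinking function *)

Definition shrink (R : rcfType) (x : R) : R :=
  if 1 < x then (Num.sqrt x)^-1 else 1.

Lemma shrink_sqr_le1 (R : rcfType) (x : R) : shrink x ^+ 2 * x <= 1.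
Proof.
rewrite /shrink; case: ltP => [x_gt1|x_le1]; last by rewrite expr1n mul1r.
have x_gt0 : 0 < x := lt_trans ltr01 x_gt1.
by rewrite exprVn sqr_sqrtr ?(ltW x_gt0) // mulVf ?(gt_eqF x_gt0).
Qed.

(** For x <= 1 only the last term survives. For x > 1 and y = sqrt x the last term vanishes and the
    others give (y - 1)^2 + 2 (y - 1) = y^2 - 1. *)
Lemma shrink_defect (R : rcfType) (x : R) : 0 <= x ->
  (1 - shrink x) ^+ 2 * x + 2 * Num.sqrt ((1 - shrink x) ^+ 2 * x)
  + (1 - shrink x ^+ 2 * x) = `|x - 1|.
Proof.
move=> x_ge0; rewrite /shrink; case: ltP => [x_gt1|x_le1]; last first.
  rewrite subrr expr0n mul0r sqrtr0 mulr0 !add0r expr1n mul1r.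
  by rewrite ler0_norm ?opprB // subr_le0.
set y := Num.sqrt x; have x_eq : x = y ^+ 2 by rewrite sqr_sqrtr.
have y_gt1 : 1 < y by rewrite -[1]sqrtr1 ltr_sqrt; lra.
have y_neq0 : y != 0 by rewrite gt_eqF //; lra.
rewrite x_eq -exprMn sqrtr_sqr mulrBl mul1r mulVf //.
rewrite ger0_norm ?subr_ge0 ?ltW // exprVn mulVf ?expf_neq0 //.
by rewrite ger0_norm; [ring|nra].
Qed.

(** * Orthonormal frames and matrices diagonal in them *)

(** The columns of all the [U i] together form an orthonormal basis. Working in such a basis makes
    every diagonal block of X diagonal at once. *)
Definition orthonormal_frames (R : realType) n N K (U : 'I_N -> 'M[R]_(n, K)) :=
  (forall i j, (U i)^T *m U j = if i == j then 1%:M else 0)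
  /\ \sum_i U i *m (U i)^T = 1%:M.

Definition frame_diag (R : realType) n N K (U : 'I_N -> 'M[R]_(n, K))
    (T : 'I_N -> 'rV_K) : 'M_n :=
  \sum_i U i *m diag_mx (T i) *m (U i)^T.

Lemma frame_diag_tr (R : realType) n N K (U : 'I_N -> 'M[R]_(n, K)) T :
  (frame_diag U T)^T = frame_diag U T.
Proof.
rewrite /frame_diag raddf_sum; apply: eq_bigr => i _.
by rewrite /= !trmx_mul trmxK tr_diag_mx mulmxA.
Qed.

Lemma frame_diag_mulr (R : realType) n N K (U : 'I_N -> 'M[R]_(n, K)) T i :
  orthonormal_frames U -> frame_diag U T *m U i = U i *m diag_mx (T i).
Proof.
case=> U_orth _; rewrite /frame_diag mulmx_suml (bigD1 i) //= big1 => [|j /negPf ji].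
  by rewrite -mulmxA U_orth eqxx mulmx1 addr0.
by rewrite -mulmxA U_orth ji mulmx0.
Qed.

(** Cyclicity of the trace brings each term to the shape of the two cross estimates, with the (j, i)
    block of [A] in the role of [B]. *)
Lemma tr_mul_frame_diag (R : realType) n N K (U : 'I_N -> 'M[R]_(n, K))
    (A X : 'M_n) S T :
  \tr (A *m frame_diag U S *m X *m frame_diag U T)
  = \sum_i \sum_j \tr ((U i *m diag_mx (S i))^T *m X
                       *m (U j *m diag_mx (T j) *m ((U j)^T *m A *m U i))).
Proof.
rewrite /frame_diag (mulmx_sumr A) !mulmx_suml raddf_sum; apply: eq_bigr => i _.
rewrite mulmx_sumr raddf_sum; apply: eq_bigr => j _ /=.
rewrite trmx_mul tr_diag_mx !mulmxA.
by rewrite [RHS]mxtrace_mulC !mulmxA [RHS]mxtrace_mulC !mulmxA.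
Qed.

(** * The rounded matrix and its distance to X *)

Section Rounding.
Context (R : realType) (n N K : nat) (X : 'M[R]_n).
Context (U : 'I_N -> 'M[R]_(n, K)) (l : 'I_N -> 'rV[R]_K).
Context (X_psd : psd X) (U_frames : orthonormal_frames U).
Context (UXU : forall i, (U i)^T *m X *m U i = diag_mx (l i)).

(** On frame [i], [f] and [e] list the eigenvalues of S and of E = 1 - S, and [g] those of the
    correction that restores the identity blocks. *)
Let f i : 'rV[R]_K := \row_k shrink (l i 0 k).
Let e i : 'rV[R]_K := \row_k (1 - shrink (l i 0 k)).
Let g i : 'rV[R]_K := \row_k (1 - shrink (l i 0 k) ^+ 2 * l i 0 k).

Definition rounding : 'M_n :=
  frame_diag U f *m X *m frame_diag U f + frame_diag U g.

Lemma frame_eigenvalue_ge0 i k : 0 <= l i 0 k.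
Proof.
have [_ /(_ (delta_mx k 0))] := psd_congr (U i) X_psd.
by rewrite UXU trmx_delta -rowE -colE !mxE eqxx.
Qed.

Lemma rounding_psd : psd rounding.
Proof.
apply: psd_add.
  by have := psd_congr (frame_diag U f) X_psd; rewrite frame_diag_tr.
apply: psd_sum => i; rewrite -{1}(trmxK (U i)); apply/psd_congr/psd_diag => k.
by rewrite mxE subr_ge0 shrink_sqr_le1.
Qed.

Lemma frame_form_diag i (d : 'rV[R]_K) :
  (U i *m diag_mx d)^T *m X *m (U i *m diag_mx d)
  = diag_mx (\row_k (d 0 k ^+ 2 * l i 0 k)).
Proof.
rewrite trmx_mul tr_diag_mx !mulmxA -[_ *m _^T *m X]mulmxA.
rewrite -[_ *m (_ *m _) *m U i]mulmxA UXU !mulmx_diag; congr diag_mx.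
by apply/rowP => k; rewrite !mxE; ring.
Qed.

Lemma rounding_unit i : (U i)^T *m rounding *m U i = 1%:M.
Proof.
have fU := frame_diag_mulr f i U_frames.
rewrite /rounding mulmxDr mulmxDl -!mulmxA fU frame_diag_mulr //.
rewrite ![_^T *m (_ *m _)]mulmxA; case: U_frames => U_orth _.
rewrite U_orth eqxx mul1mx.
have -> : (U i)^T *m frame_diag U f = (U i *m diag_mx (f i))^T.
  by rewrite -fU trmx_mul frame_diag_tr.
rewrite !mulmxA -mulmxA frame_form_diag -raddfD /= -diag_const_mx.
by congr diag_mx; apply/rowP => k; rewrite !mxE addrC subrK.
Qed.

Lemma frame_diag_fe : frame_diag U f + frame_diag U e = 1%:M.
Proof.
case: U_frames => _ <-; rewrite /frame_diag -big_split; apply: eq_bigr => i _ /=.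
rewrite -mulmxDl -mulmxDr -raddfD /=.
have -> : f i + e i = const_mx 1 by apply/rowP => k; rewrite !mxE addrC subrK.
by rewrite diag_const_mx mulmx1.
Qed.

Lemma tr_rounding_le (A : 'M_n) (s : 'I_N -> 'I_N -> R) :
  A^T = A -> (forall i j, 0 <= s i j) -> (forall i j, s i j = s j i) ->
  (forall i j, norm_bounded ((U i)^T *m A *m U j) (s i j)) ->
  \tr (A *m (X - rounding))
  <= \sum_i (\sum_k `|l i 0 k - 1|) * \sum_j s i j.
Proof.
move=> At s_ge0 s_sym s_bd.
(* [a i] is the trace of E_i D_i E_i and [b i] the trace of its square root. *)
pose a i := \sum_k e i 0 k ^+ 2 * l i 0 k.
pose b i := \sum_k Num.sqrt (e i 0 k ^+ 2 * l i 0 k).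
have [Xt _] := X_psd.
set F := frame_diag U f; set E := frame_diag U e; set G := frame_diag U g.
have X_eq : X = F *m X *m F + F *m X *m E + E *m X *m F + E *m X *m E.
  have FE : F + E = 1%:M := frame_diag_fe.
  rewrite -{1}[X]mul1mx -[X in X = _]mulmx1 -FE.
  by rewrite mulmxDl mulmxDr !mulmxDl addrACA !addrA.
(* Transposition and cyclicity identify the two mixed terms, whence the factor 2 below. *)
have FXE : \tr (A *m (F *m X *m E)) = \tr (A *m E *m X *m F).
  rewrite -mxtrace_tr !trmx_mul !frame_diag_tr Xt At mxtrace_mulC.
  by rewrite !mulmxA.
have tr_eq : \tr (A *m (X - rounding)) =
    \tr (A *m E *m X *m E) + 2 * \tr (A *m E *m X *m F) - \tr (A *m G).
  rewrite /rounding -/F -/G {1}X_eq.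
  rewrite mulmxBr !mulmxDr !raddfB !raddfD /= FXE !mulmxA; ring.
have EXE : \tr (A *m E *m X *m E) <= \sum_i a i * \sum_j s i j.
  rewrite tr_mul_frame_diag.
  apply: (@le_trans _ _ (\sum_i \sum_j s j i * ((a i + a j) / 2))).
    apply: ler_sum => i _; apply: ler_sum => j _.
    apply: le_trans (tr_cross_le_mean X_psd (frame_form_diag _ _)
      (frame_form_diag _ _) _ _ (s_ge0 j i) (s_bd j i)) _ => [k|k|].
    - by rewrite mxE mulr_ge0 ?sqr_ge0 ?frame_eigenvalue_ge0.
    - by rewrite mxE mulr_ge0 ?sqr_ge0 ?frame_eigenvalue_ge0.
    - rewrite /a; under eq_bigr => k _ do rewrite mxE.
      by under [X in _ + X]eq_bigr => k _ do rewrite mxE.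
  (* Exchanging the sums in the [a j] half turns it into the [a i] half; symmetry of [s] makes both
     weighted row sums. *)
  have -> : \sum_i \sum_j s j i * ((a i + a j) / 2)
      = (\sum_i \sum_j a i * s i j) / 2 + (\sum_i \sum_j a i * s i j) / 2.
    rewrite [X in _ + X / 2]exchange_big !mulr_suml -big_split.
    apply: eq_bigr => i _; rewrite !mulr_suml -big_split; apply: eq_bigr => j _ /=.
    rewrite (s_sym i j); ring.
  under eq_bigr => i _ do rewrite -mulr_sumr.
  lra.
have EXF : \tr (A *m E *m X *m F) <= \sum_i b i * \sum_j s i j.
  rewrite tr_mul_frame_diag; apply: ler_sum => i _; rewrite mulr_sumr.
  apply: ler_sum => j _; rewrite s_sym mulrC.
  apply: le_trans (tr_cross_le_sqrt X_psd (frame_form_diag _ _)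
    (frame_form_diag _ _) _ _ (s_ge0 j i) (s_bd j i)) _ => [k|k|].
  - by rewrite mxE mulr_ge0 ?sqr_ge0 ?frame_eigenvalue_ge0.
  - by rewrite !mxE shrink_sqr_le1.
  - by rewrite /b; under eq_bigr => k _ do rewrite mxE.
have AG : - \tr (A *m G) <= \sum_i (\sum_k g i 0 k) * \sum_j s i j.
  rewrite /G /frame_diag mulmx_sumr [\tr _]raddf_sum -sumrN; apply: ler_sum => i _.
  (* G meets only the diagonal blocks of [A], through their diagonal entries; [s i i] is one term of
     its row sum. *)
  apply: (@le_trans _ _ ((\sum_k g i 0 k) * s i i)).
    rewrite !mulmxA /= mxtrace_mulC !mulmxA mulr_suml -sumrN; apply: ler_sum => k _.
    rewrite mul_mx_diag mxE mulrC -mulrN ler_wpM2l //.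
      by rewrite mxE subr_ge0 shrink_sqr_le1.
    apply: le_trans (norm_bounded_entry k k (s_ge0 i i) (s_bd i i)).
    by rewrite -normrN ler_norm.
  rewrite ler_wpM2l //.
    by apply: sumr_ge0 => k _; rewrite mxE subr_ge0 shrink_sqr_le1.
  by rewrite (bigD1 i) //= lerDl sumr_ge0.
rewrite tr_eq; apply: le_trans (lerD (lerD EXE (ler_wpM2l _ EXF)) AG) _ => //.
rewrite mulr_sumr -!big_split /=; apply: ler_sum => i _.
rewrite mulrA -!mulrDl ler_wpM2r ?sumr_ge0 //.
rewrite mulr_sumr -!big_split /= ler_sum // => k _.
by rewrite -shrink_defect ?frame_eigenvalue_ge0 // !mxE.
Qed.

End Rounding.

(** * Coordinate blocks as frames, and the theorem *)

Definition block_incl (R : realType) N K (i : 'I_N) : 'M[R]_(\sum_(i < N) K, K) :=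
  submxrow 1%:M i.

Lemma submxblock_incl (R : realType) N K (X : 'M[R]_(\sum_(i < N) K)) i j :
  submxblock X i j = (block_incl R K i)^T *m X *m block_incl R K j.
Proof.
rewrite /block_incl tr_submxrow trmx1 submxcol_mul mul1mx.
by rewrite mul_submxrow mulmx1 submxblockEv.
Qed.

Lemma block_incl_frames (R : realType) N K :
  orthonormal_frames (@block_incl R N K).
Proof.
split=> [i j|].
  rewrite -[X in X *m _]mulmx1 -submxblock_incl -mxdiagZ mxblockK.
  by case: eqP => // _; rewrite conform_mx_id.
rewrite -[RHS]mulmx1 -{1}[1%:M]submxrowK -[X in _ *m X]submxcolK mul_mxrow_mxcol.
by apply: eq_bigr => i _; rewrite /block_incl tr_submxrow trmx1.
Qed.

Lemma frames_rotate (R : realType) n N K (U : 'I_N -> 'M[R]_(n, K))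
    (Q : 'I_N -> 'M_K) : orthonormal_frames U ->
  (forall i, (Q i)^T *m Q i = 1%:M) -> orthonormal_frames (fun i => U i *m Q i).
Proof.
move=> [U_orth U_sum] QQ; split=> [i j|].
  rewrite trmx_mul mulmxA -[_ *m _ *m U j]mulmxA U_orth.
  by case: eqP => [->|_]; rewrite ?mulmx1 ?QQ // mulmx0 mul0mx.
rewrite -U_sum; apply: eq_bigr => i _.
by rewrite trmx_mul mulmxA -[_ *m _ *m (Q i)^T]mulmxA (mulmx1C (QQ i)) mulmx1.
Qed.

Lemma norm_bounded_orthogonal (R : realType) m n (B : 'M[R]_(m, n)) s
    (P : 'M_m) (Q : 'M_n) :
  P^T *m P = 1%:M -> Q^T *m Q = 1%:M -> norm_bounded B s ->
  norm_bounded (P^T *m B *m Q) s.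
Proof.
move=> PP QQ B_bd v; have := B_bd (Q *m v).
have -> : (Q *m v)^T *m (Q *m v) = v^T *m v.
  by rewrite trmx_mul mulmxA -[_ *m Q^T *m Q]mulmxA QQ mulmx1.
have -> : P^T *m B *m Q *m v = P^T *m (B *m (Q *m v)) by rewrite !mulmxA.
move: (B *m (Q *m v)) => w.
by rewrite trmx_mul trmxK mulmxA -[_ *m P *m _]mulmxA (mulmx1C PP) mulmx1.
Qed.

Lemma nuclear_norm_ge0 (R : realType) n (B : 'M[R]_n) : 0 <= nuclear_norm B.
Proof.
have [|Q [d [QQ BB]]] := @symmetric_diagonalization R n (B^T *m B).
  by rewrite trmx_mul trmxK.
rewrite /nuclear_norm (perm_big _ (perm_singular_values QQ BB)) /= big_map.
by rewrite sumr_ge0 // => i _; rewrite sqrtr_ge0.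
Qed.

Theorem lemma30 (R : realType) (N K : nat) (X : 'M[R]_(\sum_(i < N) K))
    (delta : R) (X_sym : X^T = X) (X_psd : psd X)
    (X_diag : \sum_(i < N) nuclear_norm (submxblock X i i - 1%:M) <= delta) :
  exists X' : 'M[R]_(\sum_(i < N) K),
    [/\ psd X',
        forall i : 'I_N, submxblock X' i i = 1%:M
      & forall A : 'M[R]_(\sum_(i < N) K), A^T = A ->
          \tr (A *m (X - X')) <= (2 * K + 1)%:R * delta * block_norm A].
Proof.
have /fin_all_exists [Qd QdP] i : exists Qd : 'M[R]_K * 'rV[R]_K,
    Qd.1^T *m Qd.1 = 1%:M
    /\ submxblock X i i = Qd.1 *m diag_mx Qd.2 *m Qd.1^T.
  have [|Q [d QdP]] := @symmetric_diagonalization R K (submxblock X i i).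
    by rewrite tr_submxblock X_sym.
  by exists (Q, d).
pose Q i := (Qd i).1; pose l i := (Qd i).2.
have QQ i : (Q i)^T *m Q i = 1%:M by have [] := QdP i.
have X_ii i : submxblock X i i = Q i *m diag_mx (l i) *m (Q i)^T.
  by have [] := QdP i.
(* Rotating each coordinate block by its own eigenbasis keeps the frames orthonormal and
   diagonalizes the diagonal blocks of [X]. *)
pose U i := block_incl R K i *m Q i.
have U_frames : orthonormal_frames U := frames_rotate (block_incl_frames R N K) QQ.
have blockU (Y : 'M_(\sum_(i < N) K)) i j :
    (U i)^T *m Y *m U j = (Q i)^T *m submxblock Y i j *m Q j.
  by rewrite submxblock_incl trmx_mul !mulmxA.
have UXU i : (U i)^T *m X *m U i = diag_mx (l i).
  by rewrite blockU X_ii !mulmxA QQ mul1mx -mulmxA QQ mulmx1.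
exists (rounding X U l); split; first exact: rounding_psd.
  move=> i; have := rounding_unit U_frames UXU i; rewrite blockU.
  move/(congr1 (fun M => Q i *m M *m (Q i)^T)); rewrite mulmx1 (mulmx1C (QQ i)).
  by rewrite !mulmxA (mulmx1C (QQ i)) mul1mx -mulmxA (mulmx1C (QQ i)) mulmx1.
move=> A At.
(* The minimum is symmetric by construction. Since the (j, i) block is the transpose of the (i, j)
   block, both norms bound either block, through [norm_bounded_tr]. *)
pose s i j := Num.min (spectral_norm (submxblock A i j))
                      (spectral_norm (submxblock A j i)).
have s_ge0 i j : 0 <= s i j by rewrite le_min !spectral_norm_ge0.
have s_sym i j : s i j = s j i by rewrite /s minC.
have s_bd i j : norm_bounded ((U i)^T *m A *m U j) (s i j).
  rewrite blockU; apply: norm_bounded_orthogonal => //.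
  rewrite /s; case: leP => _; first exact: spectral_normP.
  rewrite -{1}At -tr_submxblock; apply: norm_bounded_tr; exact: spectral_normP.
have s_le i : \sum_j s i j <= block_norm A.
  apply: le_trans (le_bigmax _ _ i); apply: ler_sum => j _.
  by rewrite /s ge_min lexx.
have norm_ge0 : 0 <= block_norm A by apply: bigmax_ge_id.
apply: le_trans (tr_rounding_le X_psd U_frames UXU At s_ge0 s_sym s_bd) _.
(* The estimate with constant 1 comes first; it is relaxed to 2 K + 1 at the end, using that [delta]
   is nonnegative. *)
apply: (@le_trans _ _ (delta * block_norm A)).
  apply: le_trans (ler_wpM2r norm_ge0 X_diag); rewrite mulr_suml.
  apply: ler_sum => i _.
  rewrite (_ : nuclear_norm _ = \sum_k `|l i 0 k - 1|).
    by rewrite ler_wpM2l // sumr_ge0.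
  (* Subtracting the identity shifts the eigenvalues by 1 and keeps the eigenbasis. *)
  rewrite (@nuclear_norm_symmetric _ _ _ (Q i) (l i - const_mx 1)) //.
    by apply: eq_bigr => k _; rewrite !mxE.
  by rewrite raddfB /= diag_const_mx mulmxBr mulmxBl mulmx1 (mulmx1C (QQ i)) X_ii.
have delta_ge0 : 0 <= delta.
  by apply: le_trans X_diag; apply: sumr_ge0 => i _; exact: nuclear_norm_ge0.
by rewrite ler_wpM2r // ler_peMl // ler1n addn1.
Qed.
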